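(* Let $G$ and $H$ be graphs such that $G\times H$ is well-covered. Then (a) $G$ and $H$ are well-covered, and (b) $\alpha(G^+)\,n(H^+) = \alpha(H^+)\,n(G^+)$.
   Context: All graphs are finite and simple. The direct product $G\times H$ has vertex set $V(G)\times V(H)$, with $(g_1,h_1)(g_2,h_2)$ an edge iff $g_1g_2\in E(G)$ and $h_1h_2\in E(H)$. A graph is well-covered if all of its maximal independent sets have the same cardinality. $\alpha(\cdot)$ denotes independence number and $n(\cdot)$ the order. For a graph $G$, $G^+$ denotes the subgraph of $G$ obtained by deleting all isolated vertices of $G$.
   Formalization: In (a), G is shown well-covered when H has an edge, and H when G has an edge; without this (a) fails, e.g. G the path on 3 vertices and H a single vertex, where the product is edgeless and so well-covered but G is not. Part (b) is unrestricted. *)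

(* Defs.v *)
From HB Require Import structures.
From mathcomp Require Import all_boot.

Set Implicit Arguments.
Unset Strict Implicit.
Unset Printing Implicit Defensive.

(* The vertex type may be empty, since [delete_isolated G] below has no vertex
   when [G] has no edge. *)
Record sgraph := SGraph {
  vertex :> finType;
  edge : rel vertex;
  edge_sym : symmetric edge;
  edge_irrefl : irreflexive edge }.

Definition graph_order (G : sgraph) : nat := #|G|.

Definition has_edge (G : sgraph) : Prop := exists x y : G, edge x y.

Section DirectProduct.
Variables G H : sgraph.

Definition prod_edge : rel (G * H) :=
  fun u v => edge u.1 v.1 && edge u.2 v.2.

Lemma prod_edge_sym : symmetric prod_edge.
Proof. by move=> u v; rewrite /prod_edge edge_sym [edge u.2 _]edge_sym. Qed.

Lemma prod_edge_irrefl : irreflexive prod_edge.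
Proof. by move=> u; rewrite /prod_edge edge_irrefl. Qed.

Definition direct_product : sgraph := SGraph prod_edge_sym prod_edge_irrefl.

End DirectProduct.

Section InducedSubgraph.
Variables (G : sgraph) (S : {set G}).

Definition induced_edge : rel {x : G | x \in S} :=
  fun u v => edge (val u) (val v).

Lemma induced_edge_sym : symmetric induced_edge.
Proof. by move=> u v; rewrite /induced_edge edge_sym. Qed.

Lemma induced_edge_irrefl : irreflexive induced_edge.
Proof. by move=> u; rewrite /induced_edge edge_irrefl. Qed.

Definition induced : sgraph := SGraph induced_edge_sym induced_edge_irrefl.

End InducedSubgraph.

Definition isolated (G : sgraph) (x : G) : bool := [forall y, ~~ edge x y].

(* Usually written G^+. *)
Definition delete_isolated (G : sgraph) : sgraph :=
  induced [set x : G | ~~ isolated x].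

Definition independent (G : sgraph) (A : {set G}) : bool :=
  [forall x in A, forall y in A, ~~ edge x y].

Definition max_independent (G : sgraph) (A : {set G}) : bool :=
  maxset (@independent G) A.

Definition alpha (G : sgraph) : nat :=
  \max_(A : {set G} | independent A) #|A|.

Definition well_covered (G : sgraph) : Prop :=
  forall A B : {set G}, max_independent A -> max_independent B -> #|A| = #|B|.

(* Main.v *)
Require Import Defs.
From HB Require Import structures.
From mathcomp Require Import all_boot.

Set Implicit Arguments.
Unset Strict Implicit.
Unset Printing Implicit Defensive.

(** A maximal independent set A of G contains all isolated vertices of G, and
    the complement in G x H of (V(G) - A) x V(H^+) is a maximal independent set
    of G x H; symmetrically for a maximal independent set B of H.
    Well-coveredness of the product thus makes all the numbers
    |V(G) - A| n(H^+) and n(G^+) |V(H) - B| equal.  Varying A gives (a); taking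
    A and B to be maximum gives
    (n(G^+) - alpha(G^+)) n(H^+) = n(G^+) (n(H^+) - alpha(H^+)), which is (b). *)

(** The vertices of $G^+$, kept as a subset of $G$ so that rectangles can be formed in the
    product. *)
Definition non_isolated (G : sgraph) : {set G} := [set x | ~~ isolated x].

Lemma non_isolatedP (G : sgraph) (x : G) :
  reflect (exists y, edge x y) (x \in non_isolated G).
Proof.
rewrite inE negb_forall; apply: (iffP existsP) => -[y].
  by rewrite negbK; exists y.
by move=> xy; exists y; rewrite negbK.
Qed.

Lemma independentP (G : sgraph) (A : {set G}) :
  reflect {in A &, forall x y, ~~ edge x y} (independent A).
Proof.
apply: (iffP forall_inP) => [indA x y xA yA | indA x xA].
  exact: (forall_inP (indA x xA)).
by apply/forall_inP => y; apply: indA.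
Qed.

(** An outside vertex with no neighbour in [A] could be added to [A]; conversely, a dominated vertex
    lies in no independent superset of [A]. *)
Lemma max_independentP (G : sgraph) (A : {set G}) :
  reflect (independent A /\ forall x, x \notin A -> exists2 y, y \in A & edge x y)
          (max_independent A).
Proof.
apply: (iffP maxsetP) => [[indA maxA] | [indA domA]]; split=> //.
  move=> x xA; apply/exists_inP/contraT; rewrite negb_exists_in => /forall_inP nx.
  suff indxA: independent (x |: A).
    by rewrite -(maxA _ indxA (subsetUr _ _)) setU11 in xA.
  apply/independentP => y z /setU1P[-> | yA] /setU1P[-> | zA].
  - by rewrite edge_irrefl.
  - exact: nx.
  - by rewrite edge_sym nx.
  - exact: (independentP _ indA).
move=> B /independentP indB sAB; apply/eqP; rewrite eqEsubset sAB andbT.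
apply/subsetP => x xB; apply: contraT => /domA[y yA].
by rewrite (negPf (indB x y xB (subsetP sAB y yA))).
Qed.

Lemma max_independent_ex (G : sgraph) : exists A : {set G}, max_independent A.
Proof.
have [|A maxA _] := @maxset_exists _ (@independent G) set0.
  by apply/independentP => x y; rewrite inE.
by exists A.
Qed.

(** The ends of a product edge have non-isolated second coordinates, so if both lay in this set,
    their first coordinates would be adjacent in [A]. A vertex (x, h) outside has a neighbour y of x
    in [A] and a neighbour k of h; then (y, k) dominates it. *)
Lemma max_independent_cylinderl (G H : sgraph) (A : {set G}) :
  max_independent A ->
  @max_independent (direct_product G H) (~: setX (~: A) (non_isolated H)).
Proof.
case/max_independentP => /independentP indA domA; apply/max_independentP; split.
  apply/independentP => -[x h] [y k]; rewrite !in_setC !in_setX !in_setC /=.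
  move=> xh yk; apply/negP => /andP[/= xy hk]; move: xh yk.
  have -> : h \in non_isolated H by apply/non_isolatedP; exists k.
  have -> : k \in non_isolated H.
    by apply/non_isolatedP; exists h; rewrite edge_sym.
  by rewrite !andbT !negbK => xA yA; rewrite (negPf (indA _ _ xA yA)) in xy.
move=> [x h]; rewrite in_setC negbK in_setX in_setC /=.
case/andP => /domA[y yA xy] /non_isolatedP[k hk].
by exists (y, k); rewrite ?in_setC ?in_setX ?in_setC /= ?yA //; apply/andP.
Qed.

Lemma max_independent_swap (G H : sgraph) (S : {set G * H}) :
  @max_independent (direct_product G H) S ->
  @max_independent (direct_product H G) [set u | (u.2, u.1) \in S].
Proof.
case/max_independentP => /independentP indS domS; apply/max_independentP; split.
  apply/independentP => u v; rewrite !inE => uS vS.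
  by have := indS _ _ uS vS; rewrite /edge /= /prod_edge andbC.
move=> u; rewrite inE => /domS[v vS /andP[uv1 uv2]].
exists (v.2, v.1); first by rewrite inE -surjective_pairing.
by apply/andP.
Qed.

Lemma max_independent_cylinderr (G H : sgraph) (B : {set H}) :
  max_independent B ->
  @max_independent (direct_product G H) (~: setX (non_isolated G) (~: B)).
Proof.
move=> /(@max_independent_cylinderl H G)/max_independent_swap.
by congr max_independent; apply/setP => -[x h]; rewrite !inE /= andbC.
Qed.

(** Comparing complements suits the cylinders, whose complements are rectangles and hence counted by
    products. *)
Lemma well_covered_card_setC (G : sgraph) (A B : {set G}) :
  well_covered G -> max_independent (~: A) -> max_independent (~: B) ->
  #|A| = #|B|.
Proof.
move=> wc maxA maxB; have cAB := wc _ _ maxA maxB.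
by apply/eqP; rewrite -(eqn_add2r #|~: A|) {2}cAB !cardsC.
Qed.

Lemma edge_non_isolated_gt0 (G : sgraph) : has_edge G -> 0 < #|non_isolated G|.
Proof.
by case=> x [y xy]; apply/card_gt0P; exists x; apply/non_isolatedP; exists y.
Qed.

Lemma graph_order_delete_isolated (G : sgraph) :
  graph_order (delete_isolated G) = #|non_isolated G|.
Proof. exact: card_sig. Qed.

Lemma alpha_witness (G : sgraph) : exists2 A : {set G}, independent A & #|A| = alpha G.
Proof.
(* The empty set makes the family of independent sets nonempty, so the maximum is attained. *)
have ind0 : independent (set0 : {set G}) by apply/independentP => x y; rewrite inE.
have [A indA eA] := @eq_bigmax_cond _ (@independent G) (fun A => #|A|)
                      (introT card_gt0P (ex_intro _ set0 ind0)).
by exists A.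
Qed.

Lemma max_independent_alpha (G : sgraph) (A : {set G}) :
  independent A -> #|A| = alpha G -> max_independent A.
Proof.
move=> indA cA; apply/maxsetP; split=> // B indB sAB.
by apply/eqP; rewrite eq_sym eqEcard sAB cA; apply: leq_bigmax_cond.
Qed.

(** Isolated vertices conflict with nothing, and every other vertex outside is already dominated
    within $G^+$. *)
Lemma max_independent_delete_isolated (G : sgraph) (S : {set delete_isolated G}) :
  max_independent S -> max_independent (val @: S :|: ~: non_isolated G).
Proof.
case/max_independentP => /independentP indS domS; apply/max_independentP; split.
  have iso (x y : G) : x \in ~: non_isolated G -> ~~ edge x y.
    by rewrite in_setC; apply: contra => xy; apply/non_isolatedP; exists y.
  apply/independentP => x y /setUP[/imsetP[u uS ->] | /iso //].
  case/setUP => [/imsetP[v vS ->] | /iso]; first exact: indS.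
  by rewrite edge_sym.
move=> x; rewrite in_setU negb_or in_setC negbK => /andP[xS xU].
have [|y yS xy] := domS (exist _ x xU).
  by apply: contra xS => xS; apply/imsetP; exists (exist _ x xU).
by exists (val y) => //; rewrite in_setU imset_f.
Qed.

(** Take a maximum independent set of $G^+$ and add the isolated vertices: the complement in [G] is
    then its complement in $G^+$. The sum form avoids truncated subtraction. *)
Lemma max_independent_card_alpha (G : sgraph) :
  exists2 A : {set G}, max_independent A &
    #|~: A| + alpha (delete_isolated G) = #|non_isolated G|.
Proof.
have [S indS cS] := alpha_witness (delete_isolated G).
exists (val @: S :|: ~: non_isolated G).
  exact/max_independent_delete_isolated/max_independent_alpha.
rewrite setCU setCK setIC -setDE -cS -(card_imset _ val_inj) addnC.
have sSU : val @: S \subset non_isolated G.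
  by apply/subsetP => x /imsetP[u _ ->]; apply: valP.
by rewrite -(cardsID (val @: S) (non_isolated G)) (setIidPr sSU).
Qed.

Theorem theorem2p5 (G H : sgraph) :
  well_covered (direct_product G H) ->
  ((has_edge H -> well_covered G) /\ (has_edge G -> well_covered H)) /\
  alpha (delete_isolated G) * graph_order (delete_isolated H) = alpha (delete_isolated H) * graph_order (delete_isolated G).
Proof.
move=> wc.
have key (A : {set G}) (B : {set H}) : max_independent A -> max_independent B ->
    #|~: A| * #|non_isolated H| = #|non_isolated G| * #|~: B|.
  move=> maxA maxB; rewrite -!cardsX; apply: (well_covered_card_setC wc).
    exact: max_independent_cylinderl.
  exact: max_independent_cylinderr.
split; first split.
- move=> /edge_non_isolated_gt0 H_gt0 A A' maxA maxA'.
  (* [A] and [A'] are both compared with one fixed [B]; the edge of [H] permits cancelling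
     $n(H^+)$. *)
  have [B maxB] := max_independent_ex H.
  apply/eqP; rewrite -(eqn_add2r #|~: A|) cardsC -(cardsC A') eqn_add2l.
  by rewrite -(eqn_pmul2r H_gt0) (key _ _ maxA maxB) (key _ _ maxA' maxB).
- move=> /edge_non_isolated_gt0 G_gt0 B B' maxB maxB'.
  have [A maxA] := max_independent_ex G.
  apply/eqP; rewrite -(eqn_add2r #|~: B|) cardsC -(cardsC B') eqn_add2l.
  by rewrite -(eqn_pmul2l G_gt0) -(key _ _ maxA maxB) -(key _ _ maxA maxB').
have [A maxA cA] := max_independent_card_alpha G.
have [B maxB cB] := max_independent_card_alpha H.
apply/eqP; rewrite !graph_order_delete_isolated.
(* After adding the quantity common to both cylinders, each side becomes $n(G^+)\,n(H^+)$. *)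
rewrite -(eqn_add2l (#|~: A| * #|non_isolated H|)) -mulnDl cA (key _ _ maxA maxB).
by rewrite [alpha _ * _]mulnC -mulnDr cB.
Qed.
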